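(* Let $\Bbbk$ be an algebraically closed field, $R=\Bbbk[x_0,\dots,x_n]$, and let $I\subset R$ be a homogeneous ideal. Let $L_1,\dots,L_s$ be general linear forms. Assume that for some integer $d$: (a) there is the $d$-binomial expansion $h_d=\dim_\Bbbk [R/I]_d=\binom{a_d}{d}+\binom{a_{d-1}}{d-1}+\cdots+\binom{a_e}{e}$ with $e\ge 2$; (b) Green's Hyperplane Restriction Theorem is sharp for $R/I$ in degree $d$, i.e. $\dim_\Bbbk[R/(I,L)]_d=\big((h_d)_{(d)}\big)|^{-1}_{\phantom{-}0}$ for a general linear form $L$. Then Green's Hyperplane Restriction Theorem is successively sharp restricting modulo $L_1,\dots,L_s$; that is, for every $1\le j\le s$, $$\dim_\Bbbk[R/(I,L_1,\dots,L_j)]_d=\Big(\big(\dim_\Bbbk[R/(I,L_1,\dots,L_{j-1})]_d\big)_{(d)}\Big)\Big|^{-1}_{\phantom{-}0}.$$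
   Context: $[M]_d$ denotes the degree $d$ component of a graded module $M$. For positive integers $r,i$, the $i$-binomial expansion of $r$ is the unique expression $r_{(i)}=\binom{r_i}{i}+\binom{r_{i-1}}{i-1}+\cdots+\binom{r_j}{j}$ with $r_i>r_{i-1}>\cdots>r_j\ge j\ge 1$. For integers $a,b$ put $r_{(i)}|^{b}_{a}=\binom{r_i+b}{i+a}+\binom{r_{i-1}+b}{i-1+a}+\cdots+\binom{r_j+b}{j+a}$, where $\binom{m}{c}=0$ whenever $m<c$ or $c<0$; by convention the value for $r=0$ is $0$. Green's Hyperplane Restriction Theorem (Green's Theorem 1) states that $\dim[R/(I,L)]_d\le\big((\dim[R/I]_d)_{(d)}\big)|^{-1}_{\phantom{-}0}$ for a general linear form $L$; it is sharp in degree $d$ if equality holds. ''General linear forms'' $L_1,\dots,L_s$ means that $(L_1,\dots,L_s)$ lies in a suitable nonempty Zariski-open subset of $([R]_1)^s$. *)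

(* Defs.v *)
From Stdlib Require Import ClassicalEpsilon.
From mathcomp Require Import all_boot all_order all_algebra.
From mathcomp Require Export mpoly.
From mathcomp Require Import zify.

Set Implicit Arguments.
Unset Strict Implicit.
Unset Printing Implicit Defensive.

Import GRing.Theory.

Local Open Scope ring_scope.

(* 'C(m, c) for integers m, c; zero when m < c or c < 0. *)
Definition intbin (m c : int) : nat :=
  if (0 <= c) && (c <= m) then 'C(`|m|%N, `|c|%N) else 0%N.

(* r = 'C(c i, i) + 'C(c i.-1, i.-1) + ... + 'C(c j, j)
   with c i > ... > c j >= j >= 1. *)
Definition is_binexp (i r j : nat) (c : nat -> nat) : Prop :=
  [/\ (1 <= j <= i)%N, (j <= c j)%N,
      forall t, (j <= t < i)%N -> (c t < c t.+1)%N &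
      r = (\sum_(j <= t < i.+1) 'C(c t, t))%N].

Definition greedy (i r : nat) : nat :=
  (\max_(m < (r + i).+1 | 'C(m, i) <= r) m)%N.

(* The number r_(i)|^b_a.  The i-binomial expansion of r is computed greedily;
   binexp_exists and binshiftE below show that the
   expansion exists and that its value at (a, b) does not depend on how it is
   obtained.  The value for r = 0 is 0. *)
Fixpoint binshift (i r : nat) (a b : int) : nat :=
  if i is i'.+1 then
    if r == 0%N then 0%N
    else (intbin ((greedy i r)%:Z + b) (i%:Z + a) +
          binshift i' (r - 'C(greedy i r, i)) a b)%N
  else 0%N.

Lemma leq_binl (m m' i : nat) : (m <= m')%N -> ('C(m, i) <= 'C(m', i))%N.
Proof. exact: leq_bin2l. Qed.

Lemma ltn_bin_add (r i : nat) : (0 < i)%N -> (r < 'C(r + i, i))%N.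
Proof.
elim: r => [|r IHr] i0; first by rewrite add0n binn.
have -> : (r.+1 + i = (r + i).+1)%N by [].
case: i i0 IHr => // i _ /(_ isT) IHr.
rewrite binS.
have : (0 < 'C(r + i.+1, i))%N by rewrite bin_gt0 addnS ltnW // ltnS leq_addl.
lia.
Qed.

Lemma greedyP (i r : nat) : (0 < i)%N ->
  ('C(greedy i r, i) <= r < 'C((greedy i r).+1, i))%N.
Proof.
move=> i0; apply/andP; split.
  rewrite /greedy.
  have P0 : ('C((@ord0 (r + i)), i) <= r)%N by rewrite /= bin0n (gtn_eqF i0).
  by rewrite (bigop.bigmax_eq_arg ord0) //; case: arg_maxnP.
rewrite ltnNge; apply/negP=> le_r.
have lt_g : ((greedy i r).+1 < (r + i).+1)%N.
  rewrite ltnS leqNgt; apply/negP => lt.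
  have := leq_trans (leq_binl i (ltnW lt)) le_r.
  by rewrite leqNgt ltn_bin_add.
have := @leq_bigmax_cond _ (fun m : 'I_(r + i).+1 => 'C(m, i) <= r)%N
   (fun m => m : nat) (Ordinal lt_g) le_r.
by rewrite /= -/(greedy i r) ltnn.
Qed.

Lemma greedy_uniq (i r m : nat) : (0 < i)%N ->
  ('C(m, i) <= r < 'C(m.+1, i))%N -> greedy i r = m.
Proof.
move=> i0 /andP[le_m lt_m]; have /andP[le_g lt_g] := greedyP r i0.
apply/eqP; rewrite eqn_leq; apply/andP; split; rewrite leqNgt; apply/negP => lt.
  by have := leq_trans lt_m (leq_trans (leq_binl i lt) le_g); rewrite ltnn.
by have := leq_trans lt_g (leq_trans (leq_binl i lt) le_m); rewrite ltnn.
Qed.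

Lemma binexp_lt (i r j : nat) (c : nat -> nat) :
  is_binexp i r j c -> (i <= c i)%N /\ ('C(c i, i) <= r < 'C((c i).+1, i))%N.
Proof.
elim: i r => [|i IHi] r [/andP[j1 ji] jc inc ->].
  by case: (j) j1 ji.
have [ij|ij|/esym ji'] := ltngtP i.+1 j; first by move: ji; rewrite leqNgt ij.
  have /IHi [ic /andP[_ lt]] : is_binexp i (\sum_(j <= t < i.+1) 'C(c t, t)) j c.
    split=> //; first by rewrite j1.
    by move=> t /andP[jt ti]; apply: inc; rewrite jt ltnW.
  have ci : (c i < c i.+1)%N by apply: inc; rewrite -ltnS ij ltnSn.
  split; first exact: leq_ltn_trans ic ci.
  rewrite big_nat_recr ?(ltnW ij) //=.
  have := leq_binl i ci.
  by rewrite binS; lia.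
subst j; rewrite big_nat1 leqnn; split=> //.
rewrite binS /= -[X in (X < _)%N]addn0 ltn_add2l bin_gt0.
exact: ltnW.
Qed.

Lemma binshiftE (i r j : nat) (c : nat -> nat) (a b : int) :
  is_binexp i r j c ->
  binshift i r a b =
    (\sum_(j <= t < i.+1) intbin ((c t)%:Z + b) (t%:Z + a))%N.
Proof.
elim: i r => [|i IHi] r E.
  by case: E => /andP[]; case: (j).
have [ic bnd] := binexp_lt E; case: (E) => /andP[j1 ji] jc inc rE.
have r0 : r != 0%N.
  by case/andP: bnd => le _; rewrite -lt0n (leq_trans _ le) // bin_gt0.
rewrite [LHS]/= (negbTE r0) (greedy_uniq _ bnd) //.
rewrite big_nat_recr //= addnC; congr (_ + _)%N.
move: rE; rewrite big_nat_recr //= => ->; rewrite addnK.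
have [ij|ij] := ltnP i j; last first.
  apply: IHi; split=> //; first by rewrite j1.
  by move=> t /andP[jt ti]; apply: inc; rewrite jt ltnW.
by rewrite !big_geq //; case: (i).
Qed.

Lemma binexp_exists (i r : nat) : (0 < i)%N -> (0 < r)%N ->
  exists j c, is_binexp i r j c.
Proof.
elim: i r => // i IHi r _ r0.
have /andP[le lt] := greedyP r (ltn0Sn i); set m := greedy i.+1 r in le lt.
have im : (i < m)%N.
  rewrite ltnNge; apply/negP => mi; move: lt; rewrite binS.
  by rewrite bin_small ?ltnS //; have := leq_binl i mi; rewrite binn; lia.
have [rE|rN] := eqVneq r 'C(m, i.+1).
  exists i.+1, (fun=> m); split=> //; first by rewrite leqnn.
    by move=> t /andP[it ti]; move: it; rewrite leqNgt ti.
  by rewrite big_nat1.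
have i0 : (0 < i)%N by move: lt rN; rewrite binS lt0n; case: (i) le => // le; rewrite bin0; lia.
have [|j [c E]] := IHi (r - 'C(m, i.+1))%N i0; first by lia.
have [_ /andP[le' _]] := binexp_lt E.
case: E => /andP[j1 ji] jc inc rE.
have cm : (c i < m)%N.
  rewrite ltnNge; apply/negP => mc.
  by move: lt; rewrite binS; have := leq_binl i mc; lia.
exists j, (fun t => if t == i.+1 then m else c t); split.
- by rewrite j1 leqW.
- by rewrite ltn_eqF // ltnS.
- move=> t /andP[jt ti]; rewrite (ltn_eqF ti) eqSS.
  by have [->//|ne] := eqVneq t i; apply: inc; lia.
rewrite big_nat_recr ?leqW //= eqxx.
rewrite [X in (X + _)%N](_ : _ = \sum_(j <= t < i.+1) 'C(c t, t))%N.
  by rewrite -rE subnK.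
by apply: eq_big_nat => t /andP[_ ti]; rewrite ltn_eqF.
Qed.

Definition is_ideal (R : comNzRingType) (I : R -> Prop) : Prop :=
  [/\ I 0, forall p q, I p -> I q -> I (p + q) & forall r p, I p -> I (r * p)].

Definition homog_ideal (K : fieldType) (n : nat) (I : {mpoly K[n]} -> Prop) :=
  is_ideal I /\ forall p d, I p -> I (pihomog mdeg d p).

Definition ideal_gen (R : comNzRingType) (A : R -> Prop) : R -> Prop :=
  fun p => forall J, is_ideal J -> (forall q, A q -> J q) -> J p.

(* The subspace whose elements are the v with P v; when P is not closed under
   linear combinations there is none and the value is meaningless. *)
Definition vspace_of (K : fieldType) (V : vectType K) (P : V -> Prop) :
    {vspace V} :=
  epsilon (inhabits 0%VS) (fun U : {vspace V} => forall v, v \in U <-> P v).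

Lemma mem_vspace_of (K : fieldType) (V : vectType K) (P : V -> Prop) :
  P 0 -> (forall a u v, P u -> P v -> P (a *: u + v)) ->
  forall v, v \in vspace_of P <-> P v.
Proof.
move=> P0 Plin; apply: (epsilon_spec _ (fun U : {vspace V} => forall v, v \in U <-> P v)).
pose inP (U : {vspace V}) := forall v, v \in U -> P v.
have H m : (exists U, inP U /\ (\dim {:V} - \dim U <= m)%N) ->
    exists U : {vspace V}, forall v, v \in U <-> P v.
  elim: m => [|m IHm] [U [UP Um]].
    exists U => v; split=> [|_]; first exact: UP.
    have fU : (fullv <= U)%VS.
      by rewrite -(dimv_leqif_sup (subvf U)) eqn_leq dimvS ?subvf //= -subn_eq0 -leqn0.
    exact: (subvP fU _ (memvf v)).
  have [UE|/not_all_ex_not [v nUv]] := classic (forall v, v \in U <-> P v).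
    by exists U.
  have [Pv vU] : P v /\ v \notin U.
    have [vU|vU] := boolP (v \in U).
      by case: nUv; split=> // _; apply: UP.
    split=> //; apply: NNPP => nPv; apply: nUv; split=> [uv|/nPv []].
      by rewrite uv in vU.
  apply: IHm; exists (U + <[v]>)%VS; split.
    move=> w /memv_addP [u /UP Pu [_ /vlineP [a ->] ->]].
    by rewrite addrC; apply: Plin.
  have : (\dim U < \dim (U + <[v]>))%N.
    rewrite (ltn_leqif (dimv_leqif_sup (addvSl _ _))) subv_add subvv /=.
    by rewrite -memvE.
  by lia.
apply: (H (\dim {:V})); exists 0%VS; split; last exact: leq_subr.
by move=> v; rewrite memv0 => /eqP ->.
Qed.

(* dhomog n.+1 K d is [R]_d for R = K[x_0, ..., x_n]. *)
Definition ideal_comp (K : fieldType) (n d : nat)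
    (I : {mpoly K[n.+1]} -> Prop) : {vspace dhomog n.+1 K d} :=
  vspace_of (fun p : dhomog n.+1 K d => I p).

Lemma mem_ideal_comp (K : fieldType) (n d : nat) (I : {mpoly K[n.+1]} -> Prop)
    (p : dhomog n.+1 K d) : is_ideal I -> p \in ideal_comp d I <-> I p.
Proof.
case=> I0 ID IM; apply: (mem_vspace_of (P := fun p : dhomog n.+1 K d => I p)) => //.
move=> a u v Iu Iv.
by rewrite linearP /=; apply: ID => //; rewrite -mul_mpolyC; apply: IM.
Qed.

(* dim_K [R/I]_d, where [R/I]_d = [R]_d / [I]_d for a homogeneous ideal I. *)
Definition hilb (K : fieldType) (n : nat) (I : {mpoly K[n.+1]} -> Prop)
    (d : nat) : nat :=
  (\dim {: dhomog n.+1 K d} - \dim (ideal_comp d I))%N.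

(* Coordinates are taken in the basis vbasis {:V}; the resulting topology does
   not depend on the basis. *)
Definition zariski_open (K : fieldType) (V : vectType K) (U : V -> Prop) :=
  exists S : {mpoly K[\dim {:V}]} -> Prop,
  forall v, U v <->
    exists2 f, S f & f.@[fun i => coord (vbasis {:V}) i v] != 0.

Definition for_general (K : fieldType) (V : vectType K) (P : V -> Prop) :=
  exists U : V -> Prop,
    [/\ zariski_open U, exists v, U v & forall v, U v -> P v].

(* The ideal (I, L). *)
Definition ideal_add1 (K : fieldType) (n : nat) (I : {mpoly K[n.+1]} -> Prop)
    (L : {mpoly K[n.+1]}) : {mpoly K[n.+1]} -> Prop :=
  ideal_gen (fun p => I p \/ p = L).

(* The ideal (I, L_1, ..., L_j); L_t is L at the ordinal t - 1. *)
Definition ideal_add (K : fieldType) (n s : nat) (I : {mpoly K[n.+1]} -> Prop)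
    (L : 'I_s -> {mpoly K[n.+1]}) (j : nat) : {mpoly K[n.+1]} -> Prop :=
  ideal_gen (fun p => I p \/ exists2 t : 'I_s, (t < j)%N & p = L t).

(* Green's bound is attained in degree d on passing from R/I to R/J. *)
Definition green_sharp (K : fieldType) (n d : nat)
    (I J : {mpoly K[n.+1]} -> Prop) : Prop :=
  hilb J d = binshift d (hilb I d) 0 (- 1).

(* Main.v *)
From Stdlib Require Import Classical.
From HB Require Import structures.
Require Import Defs.
From mathcomp Require Import all_boot all_order all_algebra.
From mathcomp Require Import zify.
Import GRing.Theory.
Local Open Scope ring_scope.

(** In degree [d.+1] everything happens inside the vector space [R_(d+1)]: if
[W] is the degree [d.+1] part of [I], then the degree [d.+1] part of
[(I, L_1, ..., L_j)] is [W + L_1 R_d + ... + L_j R_d] ([ideal_comp_gen]), and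
the Hilbert function values are codimensions.  Two operations on such [W]
matter, [restr W L = W + L R_d] and [colon W L = {f in R_d | L f in W}]; they
satisfy

- [codim W = codim (colon W L) + codim (restr W L)] ([codim_colon]);
- [restr (colon W M) L] is contained in [colon (restr W L) M]
  ([colon_restr]).

Numbers are handled through padded binomial expansions: every [r] is
[macaulay d lam], the sum of the ['C(lam_t + t, t + 1)] for [t < d], with [lam]
nondecreasing; zero parts stand for the missing terms of the expansion.  Green's
operation lowers every positive part by one ([green_macaulay]), the condition
[e >= 2] says that [lam_0 = 0], and Pascal's rule gives ([macaulay_split])

  [macaulay d.+1 lam = macaulay d.+1 (decr lam) + (0 < lam_0)
                       + macaulay d (lam \o succn)].

So if restriction by a general [M] is sharp for [W] and [lam_0 = 0], then
[colon W M] has codimension exactly [macaulay d (lam \o succn)].  Green's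
theorem bounds the restriction of [colon W M] by a general [L], the inclusion
above turns that into a lower bound for [codim (restr (restr W L) M)], and
Pascal's rule shows that this bound is the Green number of [codim (restr W L)]
([sharp_restr2]).  Hence sharpness, together with [lam_0 = 0], passes from [W]
to [restr W L], and one iterates: [sharp_lower] gives the lower bound for all
tuples, [green_restriction_iter] the upper bound for one tuple of each length.

Green's theorem itself ([green_restriction]) comes from the same two facts, by
induction on the degree and on [codim W]: choose [M] with [codim (restr W M)]
minimal; were this minimum too large, [colon W M] would be so small that the
bounds for [restr W M] and [colon W M] contradict each other.

Genericity enters only through semicontinuity: in a family of subspaces spanned
by polynomially varying vectors, the locus where the dimension is at least its
value at a given point contains a nonempty open set ([general_dim_ge]).  So a
bound on a codimension that holds for one linear form holds for general ones,
and finitely many such bounds hold together ([for_general_and]). *)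

Set Implicit Arguments.
Unset Strict Implicit.
Unset Printing Implicit Defensive.

(** * Padded binomial expansions *)

Section Numbers.
Local Open Scope nat_scope.

Definition nondec (lam : nat -> nat) := {homo lam : i j / i <= j}.

(** [lam t] is the excess of the top of the binomial coefficient of lower index
[t.+1] over the least value [t] it can have.  Only [lam] below [d] matters, but
taking [lam] on all of [nat] lets the parts be shifted and truncated freely. *)
Definition macaulay (d : nat) (lam : nat -> nat) : nat :=
  \sum_(t < d) 'C(lam t + t, t.+1).

Definition decr (lam : nat -> nat) : nat -> nat := fun t => (lam t).-1.

(** Zero parts stay zero: among the sequences that [decr] sends to [lam], this is
the smallest. *)
Definition incr (lam : nat -> nat) : nat -> nat := fun t => lam t + (0 < lam t).

Definition green (d r : nat) : nat := binshift d r 0 (- 1).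

Lemma nondec_decr {lam} : nondec lam -> nondec (decr lam).
Proof. by move=> mono i j /mono; rewrite /decr; lia. Qed.

Lemma nondec_iter {lam} m : nondec lam -> nondec (iter m decr lam).
Proof. by move=> mono; elim: m => //= m; apply: nondec_decr. Qed.

Lemma nondec_incr {lam} : nondec lam -> nondec (incr lam).
Proof. by move=> mono i j /mono; rewrite /incr; lia. Qed.

Lemma nondec_shift {lam} : nondec lam -> nondec (lam \o succn).
Proof. by move=> mono i j ij; apply: mono. Qed.

Lemma incrK lam : decr (incr lam) =1 lam.
Proof. by move=> t; rewrite /incr /decr; case: (lam t) => // m; rewrite addn1. Qed.

Lemma eq_macaulay d lam mu : lam =1 mu -> macaulay d lam = macaulay d mu.
Proof. by move=> E; apply: eq_bigr => t _; rewrite E. Qed.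

Lemma macaulayS d lam :
  macaulay d.+1 lam = macaulay d lam + 'C(lam d + d, d.+1).
Proof. by rewrite /macaulay big_ord_recr. Qed.

(** The largest value with parts at most [m] is ['C(m + d, d) - 1], by the
hockey-stick identity.  Together with [macaulayS], this says that values are
compared by their top parts first. *)
Lemma macaulay_bound d lam m : nondec lam -> lam d.-1 <= m ->
  macaulay d lam < 'C(m + d, d).
Proof.
move=> mono; elim: d m => [|d IHd] m; first by rewrite /macaulay big_ord0 bin0.
move=> /= le; rewrite macaulayS addnS binS addnC -addnS.
apply: leq_add; first by apply: leq_bin2l; rewrite leq_add2r.
by apply: IHd; apply: leq_trans (mono _ _ (leq_pred d)) le.
Qed.

Lemma macaulay_eq0 d lam : (forall t, t < d -> lam t = 0) -> macaulay d lam = 0.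
Proof. by move=> E; apply: big1 => t _; rewrite E // bin_small. Qed.

(** The greedy expansion: the top part is the largest [m] that fits, and the
remainder is then small enough for the parts below to stay at most [m]. *)
Lemma macaulay_exists d m r : r < 'C(m + d, d) ->
  exists lam, [/\ nondec lam, forall t, lam t <= m & macaulay d lam = r].
Proof.
elim: d m r => [|d IHd] m r.
  by rewrite bin0; case: r => // _; exists (fun=> 0); rewrite /macaulay big_ord0.
elim: m r => [|m IHm] r.
  rewrite binn; case: r => // _.
  by exists (fun=> 0); split=> //; apply: macaulay_eq0.
have [lt _|le] := ltnP r 'C(m + d.+1, d.+1).
  have [lam [mono bnd E]] := IHm _ lt; exists lam; split=> // t.
  exact: leqW.
rewrite addSn binS => lt.
have [|lam [mono bnd E]] := IHd m.+1 (r - 'C(m + d.+1, d.+1)).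
  by rewrite addSnnS; lia.
exists (fun t => if t < d then lam t else m.+1); split.
- move=> i j ij; case: (ltnP j d) => jd; first by rewrite (leq_ltn_trans ij jd); apply: mono.
  by case: ifP.
- by move=> t; case: ifP.
rewrite macaulayS ltnn (_ : macaulay d _ = r - 'C(m + d.+1, d.+1)).
  by rewrite addSnnS subnK.
by rewrite -E; apply: eq_bigr => t _; rewrite ltn_ord.
Qed.

Lemma macaulay_onto d r : 0 < d -> exists lam, nondec lam /\ macaulay d lam = r.
Proof.
move=> d0; have [|lam [mono _ E]] := @macaulay_exists d r r; first exact: ltn_bin_add.
by exists lam.
Qed.

Lemma green_macaulay d lam : nondec lam ->
  green d (macaulay d lam) = macaulay d (decr lam).
Proof.
move=> mono; rewrite /green; elim: d => [|d IHd]; first by rewrite /macaulay !big_ord0.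
have [z|nz] := eqVneq (lam d) 0.
  have z' t : t < d.+1 -> lam t = 0 by rewrite ltnS => /mono; rewrite z; lia.
  by rewrite !macaulay_eq0 // => t /z'; rewrite /decr => ->.
have g : greedy d.+1 (macaulay d.+1 lam) = lam d + d.
  apply: greedy_uniq => //; apply/andP; split.
    by rewrite macaulayS leq_addl.
  by rewrite -addnS; apply: macaulay_bound.
rewrite [LHS]/= g.
have -> : (macaulay d.+1 lam == 0) = false.
  by rewrite macaulayS gtn_eqF // addn_gt0 bin_gt0; apply/orP; right; lia.
rewrite [X in X - _]macaulayS addnK IHd macaulayS addnC.
congr (_ + _); rewrite /intbin /decr addr0.
have -> : ((lam d + d)%:Z + -1)%R = ((lam d).-1 + d)%:Z by lia.
by rewrite /= lez_nat; case: leqP => // lt; rewrite bin_small.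
Qed.

Lemma ltn_macaulay d lam mu : nondec lam -> lam d < mu d ->
  macaulay d.+1 lam < macaulay d.+1 mu.
Proof.
move=> mono lt; apply: leq_trans (@macaulay_bound d.+1 lam (lam d) mono (leqnn _)) _.
rewrite macaulayS; apply: leq_trans (leq_addl _ _); apply: leq_bin2l.
by rewrite addnS -addSn leq_add2r.
Qed.

(** The proof compares top parts.  If they differ, lowering keeps them
different, unless the smaller one is [0]; in that case the parts of [lam] below it
are [0] as well. *)
Lemma macaulay_decr_mono d lam mu : nondec lam -> nondec mu ->
  macaulay d lam <= macaulay d mu -> macaulay d (decr lam) <= macaulay d (decr mu).
Proof.
move=> ml mm; elim: d => [|d IHd]; first by rewrite /macaulay !big_ord0.
case: (ltngtP (lam d) (mu d)) => [lt _|gt|eq].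
- have [z|nz] := eqVneq (lam d) 0.
    rewrite macaulay_eq0 // => t; rewrite ltnS => /ml; rewrite z /decr; lia.
  by apply/ltnW/ltn_macaulay; [exact: nondec_decr | rewrite /decr; lia].
- by rewrite leqNgt ltn_macaulay.
by rewrite !macaulayS /decr eq !leq_add2r.
Qed.

(** With [macaulay_decr_mono], this makes [incr] and [decr] adjoint on values:
[macaulay d mu <= macaulay d (decr lam)] if and only if
[macaulay d (incr mu) <= macaulay d lam]. *)
Lemma macaulay_decr_lt d lam mu : nondec lam -> nondec mu ->
  macaulay d lam < macaulay d (incr mu) -> macaulay d (decr lam) < macaulay d mu.
Proof.
move=> ml mm; elim: d => [|d IHd]; first by rewrite /macaulay !big_ord0.
case: (ltngtP (lam d) (incr mu d)) => [lt _|gt|eq].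
- by apply: ltn_macaulay; [exact: nondec_decr | move: lt; rewrite /decr /incr; lia].
- by rewrite ltnNge ltnW // ltn_macaulay //; apply: nondec_incr.
have := incrK mu d; rewrite !macaulayS /decr -eq => ->.
by rewrite !ltn_add2r.
Qed.

Lemma green_mono d r r' : 0 < d -> r <= r' -> green d r <= green d r'.
Proof.
move=> d0; have [lam [ml <-]] := macaulay_onto r d0.
have [mu [mm <-]] := macaulay_onto r' d0.
by rewrite !green_macaulay //; apply: macaulay_decr_mono.
Qed.

(** Pascal's rule in each term; the lowest one, ['C(lam 0, 1)], contributes the
summand [0 < lam 0]. *)
Lemma macaulay_split d lam :
  macaulay d.+1 lam =
  macaulay d.+1 (decr lam) + ((0 < lam 0) + macaulay d (lam \o succn)).
Proof.
rewrite /macaulay !big_ord_recl /= !addn0 !bin1 /decr.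
rewrite [LHS](_ : _ = lam 0 + \sum_(t < d)
    ('C((lam t.+1).-1 + t.+1, t.+2) + 'C(lam t.+1 + t, t.+1))).
  by rewrite big_split /= addnACA; congr (_ + _); case: (lam 0) => // m; rewrite addn1.
congr (_ + _); apply: eq_bigr => t _; rewrite /bump /= add1n.
by case: (lam t.+1) => [|m]; rewrite ?addSn ?addnS ?binS //= !bin_small.
Qed.

(** The least number whose Green number reaches [macaulay d.+1 c] is
[macaulay d.+1 (incr c)]; [macaulay_split] rewrites it in the form that is
compared with [codim (restr W M) + codim (colon W M)] later. *)
Lemma ltn_macaulay_incr d h c : (green d.+1 h < macaulay d.+1 c)%N -> nondec c ->
  (h < macaulay d.+1 c + ((0 < c 0) + macaulay d (incr c \o succn)))%N.
Proof.
move=> gt cm; have E := macaulay_split d (incr c).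
rewrite (eq_macaulay _ (incrK c)) in E.
have -> : (0 < c 0)%N = (0 < incr c 0)%N by rewrite /incr; case: (c 0%N).
rewrite -E ltnNge; apply/negP => /(green_mono (ltn0Sn d)).
rewrite green_macaulay ?(eq_macaulay _ (incrK c)); last exact: nondec_incr.
by rewrite leqNgt gt.
Qed.

(** When [0 < c 0] the strict inequality is absorbed by the summand [1] and
monotonicity is enough; when [c 0 = 0] the adjunction is needed to keep it
strict. *)
Lemma ltn_green_shift d x c : nondec c ->
  (x < (0 < c 0) + macaulay d.+1 (incr c \o succn))%N ->
  (green d.+1 x < (0 < c 0) + macaulay d.+1 (c \o succn))%N.
Proof.
move=> cm lt; have [xi [xm xE]] := macaulay_onto x (ltn0Sn d).
have cm' := nondec_shift cm.
rewrite -xE green_macaulay //.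
case: (c 0%N) lt => [|c0] lt; first by apply: macaulay_decr_lt; rewrite ?xE.
have := @macaulay_decr_mono d.+1 xi _ xm (nondec_incr cm').
by rewrite (eq_macaulay _ (incrK _)) ltnS; apply; rewrite xE -ltnS.
Qed.

(** The terms of lower index less than [e] are padded by zero parts; [e >= 2]
leaves room for at least one of them. *)
Lemma binexp_macaulay d r e a : is_binexp d r e a -> 2 <= e ->
  exists lam, [/\ nondec lam, lam 0 = 0 & macaulay d lam = r].
Proof.
case=> /andP[e1 ed] ea inc -> e2.
pose c t := if t.+1 < e then 0 else a t.+1 - t.
have ca t : e <= t <= d -> t <= a t.
  elim: t => [|t IHt] /andP[et td]; first by [].
  have [->//|ne] := eqVneq t.+1 e => //.
  by apply: leq_ltn_trans (inc t _); [apply: IHt | ]; lia.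
(* Beyond [d] the sequence [a] is arbitrary, so [c] is continued as a constant. *)
exists (fun t => c (minn t d.-1)); split.
- apply: homo_leq => [//|x y z|t]; first exact: leq_trans.
  have [lt|le] := ltnP t d.-1; last first.
    by have -> : minn t.+1 d.-1 = d.-1 by lia.
  have -> : minn t.+1 d.-1 = t.+1 by lia.
  rewrite /c.
  case: ltnP => // et; rewrite ltnNge (leqW et) /=.
  by have := inc t.+1; lia.
- by rewrite min0n /c e2.
rewrite /macaulay -(big_mkord xpredT (fun t => 'C(c (minn t d.-1) + t, t.+1))).
rewrite (@big_cat_nat _ _ _ e.-1) //=; last by lia.
rewrite big_nat_cond big1 ?add0n; last first.
  move=> t /andP[/andP[_ te] _]; have -> : minn t d.-1 = t by lia.
  by rewrite /c; case: ltnP => [_|]; [rewrite bin_small | lia].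
rewrite -{2}(prednK e1) big_add1 /=.
apply: eq_big_nat => t /andP[et td]; have -> : minn t d.-1 = t by lia.
rewrite /c ltnNge -{1}(prednK e1) ltnS et /= subnK //.
by apply/ltnW/ca; lia.
Qed.
End Numbers.

(** * Properties of general points *)

Section General.
Variables (k : closedFieldType) (V : vectType k).
Implicit Types (P Q : V -> Prop) (f g : {mpoly k[\dim {:V}]}) (v : V).

Definition coord_eval f v : k := f.@[fun i => coord (vbasis {:V}) i v].

Lemma for_general_nonzero f v : coord_eval f v != 0 ->
  for_general (fun v => coord_eval f v != 0).
Proof.
move=> fv; exists (fun v => coord_eval f v != 0); split=> //; last by exists v.
by exists (fun g => g = f) => w; split=> [fw|[g ->]//]; exists f.
Qed.

Lemma for_generalP P :
  for_general P <->
  exists f, (exists v, coord_eval f v != 0) /\ forall v, coord_eval f v != 0 -> P v.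
Proof.
split=> [[U [[S US] [v Uv] UP]]|[f [[v fv] fP]]].
  have [f Sf fv] := (US v).1 Uv; exists f; split; first by exists v.
  by move=> w fw; apply/UP/US; exists f.
have [U [Uo Un UP]] := for_general_nonzero fv.
by exists U; split=> // w /UP /fP.
Qed.

Lemma for_general_sub P Q :
  (forall v, P v -> Q v) -> for_general P -> for_general Q.
Proof. by move=> PQ [U [Uo Un UP]]; exists U; split=> // v /UP /PQ. Qed.

Lemma for_general_ex P : for_general P -> exists v, P v.
Proof. by case=> U [_ [v Uv] UP]; exists v; apply: UP. Qed.

(** Restriction to a line reduces questions about common nonzeros of several
polynomials to polynomials in one variable. *)
Lemma coord_eval_line f v (w : V) :
  exists p : {poly k}, forall t, p.[t] = coord_eval f (v + t *: w).
Proof.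
exists (mmap polyC (fun i => (coord (vbasis {:V}) i v)%:P +
                             (coord (vbasis {:V}) i w) *: 'X) f) => t.
rewrite /mmap /coord_eval mevalE horner_sum; apply: eq_bigr => m _.
rewrite hornerM hornerC; congr (_ * _).
rewrite /mmap1 horner_prod; apply: eq_bigr => i _.
by rewrite horner_exp hornerD hornerC hornerZ hornerX linearD linearZ /= mulrC.
Qed.

(** On the line through a nonzero of [f] and a nonzero of [g], both restrict to
nonzero univariate polynomials, whose product has a nonroot because an
algebraically closed field is infinite. *)
Lemma for_general_and P Q :
  for_general P -> for_general Q -> for_general (fun v => P v /\ Q v).
Proof.
move=> /for_generalP [f [[v fv] fP]] /for_generalP [g [[w gw] gQ]].
have [p pE] := coord_eval_line f v (w - v); have [q qE] := coord_eval_line g v (w - v).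
have : p * q != 0.
  rewrite mulf_neq0 //; apply/negP => /eqP z.
    by move: (pE 0); rewrite z horner0 scale0r addr0 => /esym/eqP; apply/negP.
  by move: (qE 1); rewrite z horner0 scale1r addrC subrK => /esym/eqP; apply/negP.
case/closed_nonrootP => t; rewrite rootE hornerM mulf_eq0 negb_or pE qE => /andP[ft gt].
apply/for_generalP; exists (f * g); split.
  by exists (v + t *: (w - v)); rewrite /coord_eval mevalM mulf_neq0.
move=> x; rewrite /coord_eval mevalM mulf_eq0 negb_or => /andP[fx gx].
by split; [apply: fP | apply: gQ].
Qed.

Lemma for_general_all (P : nat -> V -> Prop) m :
  (forall j, (j <= m)%N -> for_general (P j)) ->
  for_general (fun v => forall j, (j <= m)%N -> P j v).
Proof.
elim: m => [|m IHm] PE.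
  apply: for_general_sub (PE 0%N _) => // v Pv j.
  by rewrite leqn0 => /eqP ->.
apply: for_general_sub (for_general_and (IHm _) (PE m.+1 _)) => //.
  by move=> v [Pv Pm] j; rewrite leq_eqVlt => /predU1P[->//|/Pv].
by move=> j jm; apply: PE; apply: leqW.
Qed.

Section Families.
Variable F : vectType k.
Implicit Types (U : V -> {vspace F}) (x : V -> F).

Definition poly_section x :=
  exists f : 'I_(\dim {:F}) -> {mpoly k[\dim {:V}]},
  forall v i, coord (vbasis {:F}) i (x v) = coord_eval (f i) v.

(** A family of subspaces spanned by polynomial sections; asking only that every
vector of every member extends to a section avoids choosing generators. *)
Definition poly_family U :=
  forall v0 w, w \in U v0 ->
  exists x, [/\ poly_section x, x v0 = w & forall v, x v \in U v].

Lemma poly_section_const w : poly_section (fun=> w).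
Proof.
by exists (fun i => (coord (vbasis {:F}) i w)%:MP) => v i; rewrite /coord_eval mevalC.
Qed.

Lemma poly_sectionD x y : poly_section x -> poly_section y ->
  poly_section (fun v => x v + y v).
Proof.
move=> [f fE] [g gE]; exists (fun i => f i + g i) => v i.
by rewrite /coord_eval mevalD linearD /= fE gE.
Qed.

Lemma poly_section_linear (x : {linear V -> F}) : poly_section x.
Proof.
pose b := vbasis {:V}.
exists (fun i => \sum_(j < \dim {:V}) coord (vbasis {:F}) i (x b`_j) *: 'X_j) => v i.
rewrite {1}(coord_vbasis (memvf v)) !linear_sum /coord_eval raddf_sum /=.
by apply: eq_bigr => j _; rewrite !linearZ /= mevalXU mulrC.
Qed.

Lemma poly_family_const W : poly_family (fun=> W).
Proof. by move=> v w Ww; exists (fun=> w); split=> //; apply: poly_section_const. Qed.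

Lemma poly_familyD U U' : poly_family U -> poly_family U' ->
  poly_family (fun v => U v + U' v)%VS.
Proof.
move=> fU fU' v0 _ /memv_addP [u /fU [x [px <- xU]] [u' /fU' [y [py <- yU]] ->]].
exists (fun v => x v + y v); split=> //; first exact: poly_sectionD.
by move=> v; apply: memv_add.
Qed.

Lemma poly_family_sum (I : finType) (A : pred I) (U : I -> V -> {vspace F}) :
  (forall i, A i -> poly_family (U i)) ->
  poly_family (fun v => \sum_(i | A i) U i v)%VS.
Proof.
move=> fU; elim: (index_enum I) => [|i r IHr].
  move=> v w; rewrite big_nil => ww; have [x [px xw xU]] := @poly_family_const 0%VS v w ww.
  by exists x; split=> // u; rewrite big_nil; apply: (xU u).
move=> v0 w; rewrite big_cons; case: ifP => Ai.
  case/(poly_familyD (fU i Ai) IHr) => x [px xw xU].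
  by exists x; split=> // v; rewrite big_cons Ai.
by case/IHr => x [px xw xU]; exists x; split=> // v; rewrite big_cons Ai.
Qed.

Lemma poly_family_limg (E : vectType k) (phi : V -> 'Hom(E, F)) :
  (forall z, linear (phi^~ z)) -> poly_family (fun v => limg (phi v)).
Proof.
move=> lphi v0 _ /memv_imgP [z _ ->].
exists (phi^~ z); split=> //; last by move=> v; apply/memv_img/memvf.
pose aM := GRing.isLinear.Build _ _ _ _ _ (lphi z).
pose x : {linear V -> F} := HB.pack (phi^~ z) aM.
exact: (poly_section_linear x).
Qed.

(** Lower semicontinuity of the dimension.  Sections through a basis of [U v0]
have a coordinate matrix [ev v A] depending polynomially on [v].  It has a right
inverse [B] at [v0], so [\det (ev v A *m B)] is a polynomial in [v] that is [1]
at [v0]; wherever it is nonzero, the sections remain linearly independent. *)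
Lemma general_dim_ge U v0 : poly_family U ->
  for_general (fun v => (\dim (U v0) <= \dim (U v))%N).
Proof.
move=> fU; set r : nat := \dim (U v0); set N : nat := \dim {:F}.
have /fin_all_exists [x xP] : forall i : 'I_r, exists x : V -> F,
    [/\ poly_section x, x v0 = (vbasis (U v0))`_i & forall v, x v \in U v].
  by move=> i; apply: fU; apply/vbasis_mem/mem_nth; rewrite size_tuple.
have /fin_all_exists [f fE] : forall i : 'I_r, exists f : 'I_N -> _,
    forall v j, coord (vbasis {:F}) j (x i v) = coord_eval (f j) v.
  by move=> i; case: (xP i).
pose A : 'M_(r, N) := \matrix_(i, j) f i j.
pose ev v := map_mx (meval (fun i => coord (vbasis {:V}) i v)) : 'M_(r, N) -> 'M_(r, N).
have comb v (c : 'rV[k]_r) j :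
    (c *m ev v A) 0 j = coord (vbasis {:F}) j (\sum_i c 0 i *: x i v).
  rewrite mxE linear_sum; apply: eq_bigr => i _.
  by rewrite !mxE linearZ /= fE.
have freeA v : row_free (ev v A) -> (r <= \dim (U v))%N.
  move=> fA; pose X := [tuple x i v | i < r].
  have Xi (i : 'I_r) : X`_i = x i v by rewrite -tnth_nth tnth_mktuple.
  have fX : free X.
    apply/freeP => c cX i; pose c' := \row_i c i.
    suff : c' = 0 by move/matrixP/(_ 0 i); rewrite !mxE.
    apply: (row_free_inj fA); rewrite mul0mx; apply/rowP => j.
    rewrite comb mxE (_ : \sum__ _ = 0) ?linear0 // -[RHS]cX.
    by apply: eq_bigr => l _; rewrite mxE Xi.
  rewrite -{1}(size_tuple X) -(eqP fX); apply: dimvS; apply/span_subvP => _ /tnthP [i ->].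
  by rewrite tnth_mktuple; case: (xP i).
have [B AB] : exists B, ev v0 A *m B = 1%:M.
  apply/row_freeP/inj_row_free => c c0.
  have z : \sum_i c 0 i *: x i v0 = 0.
    rewrite [LHS](coord_vbasis (memvf _)); apply: big1 => j _.
    by rewrite -comb c0 mxE scale0r.
  apply/rowP => i; rewrite mxE.
  apply: (freeP (basis_free (vbasisP (U v0)))) => //.
  by rewrite -[RHS]z; apply: eq_bigr => l _; case: (xP l) => _ -> _.
pose D := \det (A *m map_mx (@mpolyC _ _) B).
have DE v : coord_eval D v = \det (ev v A *m B).
  rewrite /coord_eval /D -det_map_mx map_mxM; congr (\det (_ *m _)).
  by rewrite -map_mx_comp; apply/matrixP => i j; rewrite !mxE /= mevalC.
apply: for_general_sub (for_general_nonzero (f := D) (v := v0) _); last first.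
  by rewrite DE AB det1 oner_neq0.
move=> v; rewrite DE -unitfE -/(_ \in unitmx) => uM; apply/freeA/row_freeP.
by exists (B *m invmx (ev v A *m B)); rewrite mulmxA mulmxV.
Qed.
End Families.
End General.

(** * Restriction and colon of subspaces of forms *)

Section Codim.
Variables (K : fieldType) (F : vectType K).
Implicit Types W : {vspace F}.

Definition codim W : nat := (\dim {:F} - \dim W)%N.

Lemma dim_codim W : (\dim W + codim W = \dim {:F})%N.
Proof. by rewrite subnKC // dimvS // subvf. Qed.

Lemma codimS W W' : (W <= W')%VS -> (codim W' <= codim W)%N.
Proof. by move=> /dimvS; rewrite /codim; lia. Qed.

Lemma codim_le W W' : (codim W' <= codim W)%N = (\dim W <= \dim W')%N.
Proof. by have := dim_codim W; have := dim_codim W'; lia. Qed.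
End Codim.

(** The map [phi] identifies [E / phi^-1 W] with [(W + phi E) / W]. *)
Lemma codim_preim (K : fieldType) (E F : vectType K) (phi : 'Hom(E, F)) W :
  (codim (phi @^-1: W) + codim (W + limg phi) = codim W)%N.
Proof.
have := limg_ker_dim phi (phi @^-1: W).
rewrite -lpreim_cap_limg lpreimK ?capvSr // (capv_idPr _); last first.
  by rewrite -lpreim0 lpreimS // sub0v.
have := limg_ker_dim phi fullv; rewrite (capv_idPr (subvf _)).
have := dimv_sum_cap W (limg phi).
have := dim_codim W; have := dim_codim (W + limg phi)%VS.
have := dim_codim (phi @^-1: (W :&: limg phi))%VS; lia.
Qed.

Section Restriction.
Variables (k : closedFieldType) (n : nat).
Local Notation S d := (dhomog n.+1 k d).

Definition form_mul d (L : S 1) (f : S d) : S d.+1 :=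
  DHomog (dhomogM (dhomog_is_dhomog L) (dhomog_is_dhomog f)).

Lemma form_mul_is_linear d L : linear (@form_mul d L).
Proof. by move=> a f g; apply: val_inj; rewrite /= mulrDr -scalerAr. Qed.

HB.instance Definition _ d L :=
  GRing.isLinear.Build k (S d) (S d.+1) _ (@form_mul d L) (@form_mul_is_linear d L).

Definition lmul d (L : S 1) : 'Hom(S d, S d.+1) := linfun (@form_mul d L).

Lemma val_lmul d L f : val (@lmul d L f) = val L * val f.
Proof. by rewrite lfunE. Qed.

Lemma lmul_linear d (f : S d) : linear (fun L => lmul d L f).
Proof.
move=> a L M; apply: val_inj.
by rewrite val_lmul !linearP /= !val_lmul mulrDl -scalerAl.
Qed.

Definition restr d (W : {vspace S d.+1}) (L : S 1) : {vspace S d.+1} :=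
  (W + limg (lmul d L))%VS.

Definition colon d (W : {vspace S d.+1}) (L : S 1) : {vspace S d} :=
  (lmul d L @^-1: W)%VS.

Lemma restrC d (W : {vspace S d.+1}) L M : restr (restr W L) M = restr (restr W M) L.
Proof. by rewrite /restr -!addvA (addvC (limg _)). Qed.

Lemma codim_colon d (W : {vspace S d.+1}) L :
  (codim (colon W L) + codim (restr W L) = codim W)%N.
Proof. exact: codim_preim. Qed.

Lemma codim_restr_le d (W : {vspace S d.+1}) L : (codim (restr W L) <= codim W)%N.
Proof. exact/codimS/addvSl. Qed.

Lemma general_codim_restr d (W : {vspace S d.+1}) L0 m :
  (codim (restr W L0) <= m)%N ->
  for_general (fun L => codim (restr W L) <= m)%N.
Proof.
move=> le.
have fam : poly_family (restr W).
  apply: poly_familyD; first exact: poly_family_const.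
  exact/poly_family_limg/lmul_linear.
apply: for_general_sub (general_dim_ge L0 fam) => L; rewrite -codim_le => le'.
exact: leq_trans le' le.
Qed.

(** If [M f] is in [W], then [M (f + L g)] is in [W + L R], since linear forms
commute. *)
Lemma colon_restr d (W : {vspace S d.+2}) L M :
  (restr (colon W M) L <= colon (restr W L) M)%VS.
Proof.
apply/subvP => _ /memv_addP [f Wf [_ /memv_imgP [g _ ->] ->]].
rewrite /colon -memv_preim linearD /= memv_add //; first by rewrite memv_preim.
have -> : lmul d.+1 M (lmul d L g) = lmul d.+1 L (lmul d M g).
  by apply: val_inj; rewrite !val_lmul mulrCA.
exact/memv_img/memvf.
Qed.

(** If no linear form enlarges [W], then [W] contains the product of each
variable with each form of degree [d], hence all monomials. *)
Lemma restr_full d (W : {vspace S d.+1}) :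
  (forall L, codim W <= codim (restr W L))%N -> codim W = 0%N.
Proof.
move=> H.
have sub L : (limg (lmul d L) <= W)%VS.
  suff /eqP -> : W == restr W L by apply: addvSr.
  by rewrite -(dimv_leqif_eq (addvSl _ _)) eqn_leq dimvS ?addvSl //= -codim_le H.
suff -> : W = fullv by rewrite /codim subnn.
apply/eqP; rewrite eqEsubv subvf; apply/subvP => p _.
pose inW (q : {mpoly k[n.+1]}) := exists2 w, w \in W & val w = q.
suff [w Ww /val_inj <-] : inW (val p) by [].
rewrite [val p]mpolyE big_seq; apply: big_ind => [|q r [w Ww <-] [w' Ww' <-]|m mp].
- by exists 0; rewrite ?mem0v // linear0.
- by exists (w + w'); rewrite ?memvD ?linearD.
have md : mdeg m = d.+1 := dhomog_mf (dhomog_is_dhomog p) mp.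
have [i mi] : exists i, m i != 0%N.
  apply/existsP; apply: contra_eqT md; rewrite negb_exists => /forallP z.
  by rewrite mdegE big1 // => i _; apply/eqP; move: (z i); rewrite negbK.
have mE : m = (U_(i) + (m - U_(i)))%MM by rewrite addmC submK // lep1mP.
have hX : ('X_i : {mpoly k[n.+1]}) \is 1.-homog by rewrite dhomogX /= mdeg1.
have hm : ('X_[m - U_(i)] : {mpoly k[n.+1]}) \is d.-homog.
  by rewrite dhomogX /=; move: md; rewrite {1}mE mdegD mdeg1 add1n => -[->].
exists ((val p)@_m *: lmul d (DHomog hX) (DHomog hm)).
  by apply/memvZ/(subvP (sub _))/memv_img/memvf.
by rewrite linearZ /= val_lmul /= -mpolyXD -mE.
Qed.
End Restriction.

(** * Green's theorem and the propagation of sharpness *)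

Section Green.
Variables (k : closedFieldType) (n : nat).
Local Notation S d := (dhomog n.+1 k d).

Lemma restr_min d (W : {vspace S d.+1}) :
  exists M, forall L, (codim (restr W M) <= codim (restr W L))%N.
Proof.
have [m] := ubnP (codim (restr W 0)); move: 0 => M.
elim: m M => // m IHm M; rewrite ltnS => le.
have [min|/not_all_ex_not [L /negP]] :=
  classic (forall L, (codim (restr W M) <= codim (restr W L))%N).
  by exists M.
by rewrite -ltnNge => lt; apply: (IHm L); apply: leq_trans lt le.
Qed.

(** The estimate behind both main arguments: it bounds a double restriction from
below through the restriction of a space of lower degree. *)
Lemma codim_restr2 d (W : {vspace S d.+2}) L M :
  (codim (restr W L) <=
   codim (restr (restr W L) M) + codim (restr (colon W M) L))%N.
Proof.
rewrite -[X in (X <= _)%N](codim_colon _ M) addnC leq_add2l.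
exact/codimS/colon_restr.
Qed.

(** Only one form is asked for: by semicontinuity the bound then holds for
general ones. *)
Definition green_at d := forall W : {vspace S d.+1},
  exists L, (codim (restr W L) <= green d.+1 (codim W))%N.

(** Choosing [L] general allows [codim (restr (restr W M) L)] and
[codim (restr (colon W M) L)] to be bounded at once, and [codim_restr2]
combines them. *)
Lemma restr_le_restr2 d (W : {vspace S d.+2}) M L0 : green_at d ->
  exists L, (codim (restr W L) <= codim (restr (restr W M) L0) +
                                  green d.+1 (codim (colon W M)))%N.
Proof.
move=> /(_ (colon W M)) [L1 L1le].
have [L [le1 le2]] := for_general_ex (for_general_and
  (general_codim_restr (leqnn (codim (restr (restr W M) L0))))
  (general_codim_restr L1le)).
by exists L; apply: leq_trans (codim_restr2 W L M) _; rewrite restrC leq_add.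
Qed.

(** The second assumption contradicts Green's theorem; the conclusions are what
its proof feeds to the two induction hypotheses. *)
Lemma green_failure d (W : {vspace S d.+1}) M :
  (forall L, codim (restr W M) <= codim (restr W L))%N ->
  (green d.+1 (codim W) < codim (restr W M))%N ->
  exists c, [/\ nondec c, codim (restr W M) = macaulay d.+1 c,
    (codim (restr W M) < codim W)%N &
    (codim (colon W M) < (0 < c 0) + macaulay d (incr c \o succn))%N].
Proof.
move=> Mmin gt; have [c [cm cE]] := macaulay_onto (codim (restr W M)) (ltn0Sn d).
exists c; split=> //.
  rewrite ltnNge; apply/negP => ge.
  have := restr_full (fun L => leq_trans ge (Mmin L)).
  by have := codim_restr_le W M; move: gt; lia.
rewrite -cE in gt; have := ltn_macaulay_incr gt cm.
by rewrite cE -(codim_colon W M) addnC ltn_add2l.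
Qed.

(** Green's hyperplane restriction theorem, for arbitrary subspaces of forms.  If
a form [M] with minimal [c = codim (restr W M)] violated the bound, then, with
[x = codim (colon W M)], the bounds for [restr W M] (smaller codimension) and
[colon W M] (smaller degree) would give [c <= green c + green x], whereas
[ltn_green_shift] and [macaulay_split] say that [green x < c - green c].  In
degree one [x] would vanish, so that [restr W M] would be no larger than
[W]. *)
Theorem green_restriction d : green_at d.
Proof.
elim: d => [|d IHd] W; have [m] := ubnP (codim W);
  elim: m W => // m IHm W; rewrite ltnS => Wm;
  have [M Mmin] := restr_min W; exists M; rewrite leqNgt; apply/negP => gt;
  have [c [cm cE lt x_lt]] := green_failure Mmin gt.
  by move: x_lt; rewrite /macaulay big_ord0 addn0; have := codim_colon W M; lia.
have [L0 L0le] := IHm _ (leq_trans lt Wm).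
have [L Lle] := restr_le_restr2 W M L0 IHd.
have := ltn_green_shift cm x_lt; have := Mmin L.
move: L0le; rewrite cE green_macaulay // {1}(macaulay_split _ c); lia.
Qed.

Lemma green_restriction_iter d (W : {vspace S d.+1}) j :
  exists L : nat -> S 1,
  (codim (W + \sum_(t < j) limg (lmul d (L t))) <= iter j (green d.+1) (codim W))%N.
Proof.
elim: j => [|j [L IH]]; first by exists (fun=> 0); rewrite big_ord0 addv0.
have [M le] := green_restriction (W + \sum_(t < j) limg (lmul d (L t)))%VS.
exists (fun t => if (t < j)%N then L t else M).
rewrite big_ord_recr /= ltnn addvA.
rewrite (eq_bigr (fun t : 'I_j => limg (lmul d (L t)))); last by move=> t _; rewrite ltn_ord.
exact: leq_trans le (green_mono (ltn0Sn d) IH).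
Qed.

(** For all forms: by Green's theorem and semicontinuity this is the same as
equality for general ones. *)
Definition sharp_space d (W : {vspace S d.+1}) :=
  forall L, (green d.+1 (codim W) <= codim (restr W L))%N.

(** If [L], [M] violated the bound, then so would general pairs by
semicontinuity, one form at a time: first [M] is moved to an [M1] for which the
restriction of [W] is sharp, then [L] to an [L1] for which Green's bound holds
for [colon W M1].  For that pair, [restr_le_restr2] and [macaulay_split] applied
to [lam] and to [decr lam] give the bound. *)
Lemma sharp_restr2 d (W : {vspace S d.+1}) lam L M :
  nondec lam -> lam 0%N = 0%N -> codim W = macaulay d.+1 lam -> sharp_space W ->
  (macaulay d.+1 (decr (decr lam)) <= codim (restr (restr W L) M))%N.
Proof.
case: d W L M => [|d] W L M mono lam0 hE shW.
  (* In degree one the bound is [0], because [lam 0 = 0]. *)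
  by rewrite macaulay_eq0 // => -[|//]; rewrite /decr lam0.
rewrite leqNgt; apply/negP => lt.
have [M0 M0le] := green_restriction W.
have [M1 [/= lt1 eq1]] := for_general_ex (for_general_and
  (general_codim_restr (leqnn (codim (restr (restr W L) M))))
  (general_codim_restr M0le)).
have [L1 le2] := restr_le_restr2 W M1 L (@green_restriction d).
have := codim_colon W M1; have := shW L1; have := shW M1.
rewrite (restrC W M1) in le2.
have s1 := macaulay_split d.+1 lam; have s2 := macaulay_split d.+1 (decr lam).
have dlam0 : decr lam 0%N = 0%N by rewrite /decr lam0.
rewrite lam0 add0n in s1; rewrite dlam0 add0n in s2.
move: eq1 le2; rewrite hE green_macaulay // s1 => eq1 le2 ge1 ge2 cc.
have xE : codim (colon W M1) = macaulay d.+1 (lam \o succn) by lia.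
rewrite xE green_macaulay in le2; last exact: nondec_shift.
change (decr lam \o succn) with (decr (lam \o succn)) in s2.
lia.
Qed.

Lemma sharp_restr d (W : {vspace S d.+1}) lam L :
  nondec lam -> lam 0%N = 0%N -> codim W = macaulay d.+1 lam -> sharp_space W ->
  codim (restr W L) = macaulay d.+1 (decr lam) -> sharp_space (restr W L).
Proof.
move=> mono lam0 hE shW E M; rewrite E green_macaulay; last exact: nondec_decr.
exact: sharp_restr2 hE shW.
Qed.

(** The first form may be replaced by one for which the restriction of [W] is
sharp, as this can only lower the codimension; the remaining forms then restrict
a space that is again sharp. *)
Lemma sharp_lower d (W : {vspace S d.+1}) lam j (L : nat -> S 1) :
  nondec lam -> lam 0%N = 0%N -> codim W = macaulay d.+1 lam -> sharp_space W ->
  (macaulay d.+1 (iter j decr lam) <= codim (W + \sum_(t < j) limg (lmul d (L t))))%N.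
Proof.
elim: j W lam L => [|j IHj] W lam L mono lam0 hE shW; first by rewrite big_ord0 addv0 hE.
set T := (\sum_(t < j) limg (lmul d (L t.+1)))%VS.
have E M : (W + (limg (lmul d M) + T))%VS = restr (W + T) M.
  by rewrite /restr (addvC _ T) addvA.
have [M0 M0le] := green_restriction W.
have [M [/= le1 le2]] := for_general_ex (for_general_and
  (general_codim_restr (leqnn (codim (restr (W + T) (L 0%N)))))
  (general_codim_restr M0le)).
have cE : codim (restr W M) = macaulay d.+1 (decr lam).
  by apply/eqP; rewrite -green_macaulay // -hE eqn_leq le2 shW.
rewrite big_ord_recl -iterS iterSr.
have := IHj (restr W M) (decr lam) (L \o succn) (nondec_decr mono) _ cE
  (sharp_restr mono lam0 hE shW cE).
rewrite /decr lam0 => /(_ erefl) /leq_trans -> //.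
by rewrite /= E (leq_trans _ le1) // -E /restr addvA.
Qed.
End Green.

(** * Graded pieces of ideals *)

Section Ideals.
Variables (k : closedFieldType) (n : nat).
Local Notation S d := (dhomog n.+1 k d).
Implicit Types I : {mpoly k[n.+1]} -> Prop.

Lemma ideal_gen_ideal (R : comNzRingType) (A : R -> Prop) : is_ideal (ideal_gen A).
Proof.
split=> [J [J0 _ _] _ //|p q Ap Aq J JI AJ|r p Ap J JI AJ].
  by case: (JI) => _ JD _; apply: JD; [apply: Ap | apply: Aq].
by case: (JI) => _ _ JM; apply: JM; apply: Ap.
Qed.

(** Multiplication by a linear form shifts homogeneous components by one. *)
Lemma pihomog_mulr d (p L : {mpoly k[n.+1]}) : L \is 1.-homog ->
  pihomog mdeg d.+1 (p * L) = pihomog mdeg d p * L.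
Proof.
move=> hL; pose l := (msize p + d.+1)%N.
have pE : p = \sum_(i < l) pihomog mdeg i p.
  by apply: pihomog_partitionE; apply: leq_addr.
rewrite {1}pE mulr_suml linear_sum /=.
have homM i : pihomog mdeg i p * L \is i.+1.-homog.
  by rewrite mulrC; apply: (dhomogM hL (pihomogP _ _ _)).
have dl : (d < l)%N by rewrite /l; lia.
rewrite (bigD1 (Ordinal dl)) //= big1 ?addr0 => [|i id].
  exact/pihomog_dE/homM.
apply: (@pihomog_ne0 _ _ _ i.+1); last exact: homM.
by rewrite eqSS; apply: contraNneq id => E; apply/eqP/val_inj.
Qed.

(** An element of the generated ideal is [i + \sum_t g_t L_t] with [i] in [I];
taking components of degree [d.+1] replaces each [g_t] by its component of
degree [d]. *)
Lemma ideal_comp_gen I (A : {mpoly k[n.+1]} -> Prop) (T : finType) (P : pred T)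
    (L : T -> S 1) d :
  homog_ideal I -> (forall p, A p <-> I p \/ exists2 t, P t & p = L t) ->
  ideal_comp d.+1 (ideal_gen A) =
    (ideal_comp d.+1 I + \sum_(t | P t) limg (lmul d (L t)))%VS.
Proof.
move=> [II Ihom] AE; apply/vspaceP => v; apply/idP/idP; last first.
  move=> /memv_addP [u uI [w wL ->]]; apply: memvD.
    apply/mem_ideal_comp; first exact: ideal_gen_ideal.
    move=> J JI AJ; apply/AJ/AE; left; exact/(mem_ideal_comp u II).
  move: w wL; apply/subvP/subv_sumP => t Pt; apply/subvP => _ /memv_imgP [f _ ->].
  apply/mem_ideal_comp; first exact: ideal_gen_ideal.
  move=> J [J0 JD JM] AJ.
  have -> : (lmul d (L t) f : {mpoly k[n.+1]}) = val f * val (L t).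
    by rewrite mulrC -val_lmul.
  by apply/JM/AJ/AE; right; exists t.
move=> /(mem_ideal_comp _ (ideal_gen_ideal A)) Av.
pose J (p : {mpoly k[n.+1]}) :=
  exists i g, I i /\ p = i + \sum_(t | P t) g t * val (L t).
have [i [g [Ii vE]]] : J v.
  case: II => I0 ID IM; apply: Av.
    split.
    - exists 0, (fun=> 0); split=> //.
      by rewrite big1 ?addr0 // => t _; rewrite mul0r.
    - move=> _ _ [i [g [Ii ->]]] [j [h [Ij ->]]].
      exists (i + j), (fun t => g t + h t); split; first exact: ID.
      rewrite addrACA -big_split /=; congr (_ + _).
      by apply: eq_bigr => t _; rewrite mulrDl.
    move=> r _ [i [g [Ii ->]]]; exists (r * i), (fun t => r * g t).
    split; first exact: IM.
    rewrite mulrDr mulr_sumr; congr (_ + _).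
    by apply: eq_bigr => t _; rewrite mulrA.
  move=> q /AE [Iq|[t Pt ->]].
    by exists q, (fun=> 0); split=> //; rewrite big1 ?addr0 // => t _; rewrite mul0r.
  exists 0, (fun u => (u == t)%:R); split=> //.
  rewrite add0r (bigD1 t) //= eqxx mul1r big1 ?addr0 // => u /andP[_ /negbTE ->].
  by rewrite mul0r.
have -> : v = DHomog (pihomogP mdeg d.+1 i) +
    \sum_(t | P t) lmul d (L t) (DHomog (pihomogP mdeg d (g t))).
  apply: val_inj; rewrite linearD linear_sum /=.
  rewrite -[val v](pihomog_dE (dhomog_is_dhomog v)) [\val v]vE linearD linear_sum /=.
  congr (_ + _); apply: eq_bigr => t _.
  by rewrite pihomog_mulr ?dhomog_is_dhomog // val_lmul /= mulrC.
apply: memv_add; first by apply/mem_ideal_comp => //; apply: Ihom.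
by apply: memv_sumr => t Pt; apply/memv_img/memvf.
Qed.

Lemma hilb_codim I d : hilb I d = codim (ideal_comp d I).
Proof. by []. Qed.

Lemma hilb_add1 I (L : S 1) d : homog_ideal I ->
  hilb (ideal_add1 I L) d.+1 = codim (restr (ideal_comp d.+1 I) L).
Proof.
move=> hI; rewrite hilb_codim /restr; congr (codim _).
rewrite (@ideal_comp_gen I _ unit xpredT (fun=> L)) //; last first.
  by move=> p; split=> [[]|[|[]]]; [left | right; exists tt | left | right].
by congr (_ + _)%VS; rewrite (big_pred1 tt) // => -[].
Qed.

Lemma hilb_add I s (L : 'I_s -> S 1) (L' : nat -> S 1) j d :
  homog_ideal I -> (j <= s)%N -> (forall t : 'I_s, L' t = L t) ->
  hilb (ideal_add I L j) d.+1 =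
    codim (ideal_comp d.+1 I + \sum_(t < j) limg (lmul d (L' t))).
Proof.
move=> hI js LE; rewrite hilb_codim; congr (codim _).
rewrite (@ideal_comp_gen I _ 'I_s (fun t => (t < j)%N) L) //.
congr (_ + _)%VS; rewrite (big_ord_widen s (fun t => limg (lmul d (L' t)))) //.
by apply: eq_bigr => t _; rewrite LE.
Qed.

End Ideals.

Unset Implicit Arguments.

(** * Successive sharpness *)

Theorem corollary3p11 (k : closedFieldType) (n s d : nat)
    (I : {mpoly k[n.+1]} -> Prop)
    (homI : homog_ideal I)
    (e : nat) (a : nat -> nat)
    (expansion : is_binexp d (hilb I d) e a) (e_ge2 : (2 <= e)%N)
    (sharp : for_general (fun L : dhomog n.+1 k 1 =>
       green_sharp d I (ideal_add1 I L))) :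
  for_general (fun L : {ffun 'I_s -> dhomog n.+1 k 1} =>
    forall j : nat, (1 <= j <= s)%N ->
      green_sharp d (ideal_add I (fun t => L t) j.-1)
                    (ideal_add I (fun t => L t) j)).
Proof.
case: d expansion sharp => [[/andP[]]|d expansion sharp_I]; first by move: e_ge2; lia.
have [lam [mono lam0 lamE]] := binexp_macaulay expansion e_ge2.
set W := ideal_comp d.+1 I.
have hW : codim W = macaulay d.+1 lam by rewrite lamE.
have shW : sharp_space W.
  move=> L.
  have [M [/= le E]] := for_general_ex (for_general_and
    (general_codim_restr (leqnn (codim (restr W L)))) sharp_I).
  by rewrite -[green _ _]E hilb_add1.
(* Extending tuples by zero lets all partial sums range over natural numbers. *)
pose ext (L : {ffun 'I_s -> dhomog n.+1 k 1}) t : dhomog n.+1 k 1 :=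
  oapp L 0 (insub t).
have extE L (t : 'I_s) : ext L t = L t by rewrite /ext valK.
pose WL L j := (W + \sum_(t < j) limg (lmul d (ext L t)))%VS.
(* By semicontinuity one good tuple for each [j] is enough. *)
have upper : for_general (fun L => forall j, (j <= s)%N ->
    (codim (WL L j) <= macaulay d.+1 (iter j decr lam))%N).
  apply: for_general_all => j js.
  have [L0 L0le] := green_restriction_iter W j.
  pose L1 : {ffun 'I_s -> dhomog n.+1 k 1} := [ffun t : 'I_s => L0 t].
  have fam : poly_family (WL^~ j).
    apply: poly_familyD; first exact: poly_family_const.
    apply: poly_family_sum => t _.
    apply: (@poly_family_limg _ _ _ _ (fun L => lmul d (ext L t))) => z b L M.
    have ts : (t < s)%N := leq_trans (ltn_ord t) js.
    have E N : ext N t = N (Ordinal ts) by rewrite -extE.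
    by rewrite !E !ffunE lmul_linear.
  apply: for_general_sub (general_dim_ge L1 fam) => L; rewrite -codim_le => /leq_trans; apply.
  rewrite (_ : WL L1 j = (W + \sum_(t < j) limg (lmul d (L0 t)))%VS); last first.
    congr (_ + _)%VS; apply: eq_bigr => t _.
    by rewrite (extE L1 (Ordinal (leq_trans (ltn_ord t) js))) ffunE.
  apply: leq_trans L0le _; rewrite hW leq_eqVlt; apply/orP; left; apply/eqP.
  by elim: (j) => // i IHi; rewrite !iterS IHi green_macaulay //; apply: nondec_iter.
apply: for_general_sub upper => L upper j /andP[j1 js].
have codimE i : (i <= s)%N -> codim (WL L i) = macaulay d.+1 (iter i decr lam).
  by move=> le; apply/eqP; rewrite eqn_leq upper // sharp_lower.
have js' : (j.-1 <= s)%N := leq_trans (leq_pred j) js.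
rewrite /green_sharp (hilb_add _ _ js (extE L)) // (hilb_add _ _ js' (extE L)) //.
rewrite [LHS]codimE // [X in binshift _ X]codimE //.
rewrite -/(green _ _) green_macaulay; last exact: nondec_iter.
by rewrite -iterS prednK.
Qed.
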